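(* Let $\nu$ be a magnetic potential on $\Gamma_n$. For each $j\in\mathbb{N}_n$, the operator $\Xi_j^{(\nu)}:=e^{-\mathrm{i}\nu_j}\partial_j^*+e^{\mathrm{i}\nu_j}\partial_j$ is a unitary involution (i.e. a self-adjoint unitary operator) on $\mathfrak{h}_n$. Moreover, two vertices $\sigma,\tau\in\Gamma_n$ are adjacent if and only if there exists a unique $j\in\mathbb{N}_n$ such that $$\Xi_j^{(\nu)}Z_\sigma=\big[(1-\mathbf{1}_\sigma(j))e^{-\mathrm{i}\nu_j}+\mathbf{1}_\sigma(j)e^{\mathrm{i}\nu_j}\big]Z_\tau.$$
   Context: Fix an integer $n\ge 0$. $\mathbb{N}_n=\{0,1,\dots,n\}$ and $\Gamma_n$ is the power set of $\mathbb{N}_n$. Two elements $\sigma,\tau\in\Gamma_n$ are adjacent if the symmetric difference $\sigma\triangle\tau$ has exactly one element. $\mathfrak{h}_n$ is the complex Hilbert space of dimension $2^{n+1}$ with orthonormal basis $\{Z_\sigma\mid\sigma\in\Gamma_n\}$. For $j\in\mathbb{N}_n$, the operators $\partial_j$ and $\partial_j^*$ on $\mathfrak{h}_n$ are the (mutually adjoint) linear operators determined by $\partial_jZ_\sigma=\mathbf{1}_\sigma(j)Z_{\sigma\setminus\{j\}}$ and $\partial_j^*Z_\sigma=(1-\mathbf{1}_\sigma(j))Z_{\sigma\cup\{j\}}$, where $\mathbf{1}_\sigma$ is the indicator function of $\sigma$. A magnetic potential on $\Gamma_n$ is a function $\nu:\Gamma_n\times\Gamma_n\to[-\pi,\pi]$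 with $\nu(\sigma,\tau)=-\nu(\tau,\sigma)$ for all $\sigma,\tau\in\Gamma_n$. Put $\nu_j=\nu(\{j\},\mathbb{N}_n\setminus\{j\})$ for $j\in\mathbb{N}_n$. *)

(* Defs.v *)
From mathcomp Require Import all_boot all_order all_algebra.
From mathcomp Require Import reals trigo.
From mathcomp Require Import complex.

Set Implicit Arguments.
Unset Strict Implicit.
Unset Printing Implicit Defensive.

Import Order.TTheory GRing.Theory Num.Theory.
Local Open Scope ring_scope.

(* e^{i t} for a real t, by Euler's formula. *)
Definition expi (R : realType) (t : R) : R[i] := (cos t +i* sin t)%C.

Section Operators.
Variables (R : realType) (V : vectType R[i]) (dotV : {dot V for Num.conj}).

Definition adjoint_pair (f g : 'End(V)) : Prop :=
  forall u v : V, dotV (f u) v = dotV u (g v).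

Definition self_adjoint (f : 'End(V)) : Prop := adjoint_pair f f.

(* The adjoint for [dotV] is unique, so [g] is f^*: this is f^* f = f f^* = 1. *)
Definition unitary_op (f : 'End(V)) : Prop :=
  exists g : 'End(V),
    [/\ adjoint_pair f g, (g \o f = \1)%VF & (f \o g = \1)%VF].

Definition unitary_involution (f : 'End(V)) : Prop :=
  self_adjoint f /\ unitary_op f.

Definition orthonormal_basis (I : finType) (Z : I -> V) : Prop :=
  orthonormal dotV (codom Z) /\ basis_of fullv (codom Z).

End Operators.

Section PowerSet.
Variables (R : realType) (n : nat).
Local Notation Gamma := {set 'I_n.+1}.

Definition adjacent (s t : Gamma) : Prop := #|(s :\: t) :|: (t :\: s)| = 1%N.

Definition magnetic_potential (nu : Gamma -> Gamma -> R) : Prop :=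
  (forall s t, - pi <= nu s t <= pi) /\ (forall s t, nu s t = - nu t s).

(* nu_j = nu({j}, N_n \ {j}), where N_n = {0, ..., n} = 'I_n.+1. *)
Definition nu_at (nu : Gamma -> Gamma -> R) (j : 'I_n.+1) : R :=
  nu [set j] ([set: 'I_n.+1] :\ j).

Definition indic (s : Gamma) (j : 'I_n.+1) : R[i] := (j \in s)%:R.

Variables (V : vectType R[i]) (Z : Gamma -> V).

(* [Z] will be a basis, so each of these two conditions determines the operators
   completely: [d j] is \partial_j and [ds j] is \partial_j^*. *)
Definition annihilators (d : 'I_n.+1 -> 'End(V)) : Prop :=
  forall j s, d j (Z s) = indic s j *: Z (s :\ j).

Definition creators (ds : 'I_n.+1 -> 'End(V)) : Prop :=
  forall j s, ds j (Z s) = (1 - indic s j) *: Z (j |: s).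

Definition Xi (nu : Gamma -> Gamma -> R) (d ds : 'I_n.+1 -> 'End(V))
    (j : 'I_n.+1) : 'End(V) :=
  expi (- nu_at nu j) *: ds j + expi (nu_at nu j) *: d j.

End PowerSet.

(* Main.v *)
(* On basis vectors the operator Xi_j is a phase of modulus 1 times the toggling
   of j; the phases at a set and at its toggle are conjugate, so Xi_j is
   self-adjoint and squares to 1. Toggling j sends s to t exactly when the
   symmetric difference of s and t is {j}. *)
Require Import Defs.
From mathcomp Require Import all_boot all_order all_algebra.
From mathcomp Require Import reals trigo complex.

Set Implicit Arguments.
Unset Strict Implicit.
Unset Printing Implicit Defensive.

Import Order.TTheory GRing.Theory Num.Theory.
Local Open Scope ring_scope.

Section Toggle.
Variable (T : finType).

Definition toggle (j : T) (s : {set T}) : {set T} :=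
  if j \in s then s :\ j else j |: s.

(** Membership becomes an exclusive or, so that identities between toggles reduce to Boolean
    ones. *)
Lemma in_toggle (j k : T) (s : {set T}) :
  (k \in toggle j s) = (k == j) (+) (k \in s).
Proof.
rewrite /toggle; case: ifP => js; rewrite !inE;
by case: eqP => [->|_] //=; rewrite js.
Qed.

Lemma toggleK (j : T) : involutive (toggle j).
Proof. by move=> s; apply/setP=> k; rewrite !in_toggle addKb. Qed.

Lemma toggle_symdiff (j : T) (s t : {set T}) :
  toggle j s = t <-> (s :\: t) :|: (t :\: s) = [set j].
Proof.
split=> [<-|/setP st]; apply/setP=> k.
- by rewrite !inE in_toggle; case: (k == j); case: (k \in s).
- move: (st k); rewrite in_toggle !inE => <-.
  by case: (k \in s); case: (k \in t).
Qed.

End Toggle.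

(** Uniqueness comes for free: a toggle index is the sole element of the symmetric difference, and
    singletons determine their element. *)
Lemma adjacent_toggle (n : nat) (s t : {set 'I_n.+1}) :
  adjacent s t <-> exists! j, toggle j s = t.
Proof.
split=> [/eqP/cards1P[j st] | [j [/toggle_symdiff st _]]].
- exists j; split=> [|k /toggle_symdiff]; first exact/toggle_symdiff.
  by rewrite st => /set1_inj.
- by rewrite /adjacent st cards1.
Qed.

Section Expi.
Variable R : realType.
Implicit Type x : R.

Lemma expiNl x : expi (- x) * expi x = 1.
Proof.
apply/eqP; rewrite /expi cosN sinN eq_complex /=.
by rewrite mulNr opprK -!expr2 cos2Dsin2 mulNr mulrC addrN !eqxx.
Qed.

Lemma expi_neq0 x : expi x != 0.
Proof.
by apply: contra_eq_neq (expiNl x) => ->; rewrite mulr0 eq_sym oner_neq0.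
Qed.

Lemma conj_expi x : Num.conj (expi x) = expi (- x).
Proof. by rewrite /expi cosN sinN. Qed.

End Expi.

(** Coordinates in a tuple are numbered by ordinals; reindexing along [enum_rank] turns them into a
    family over [I]. *)
Lemma span_codom (K : fieldType) (V : vectType K) (I : finType) (Z : I -> V) v :
  v \in <<codom Z>>%VS -> exists c : I -> K, v = \sum_i c i *: Z i.
Proof.
rewrite -[codom Z]/(tval (codom_tuple Z)) => /coord_span ->.
exists (fun i => coord (codom_tuple Z) (enum_rank i) v).
rewrite (reindex_onto (@enum_rank I) enum_val) /=.
  apply: eq_big => i; first by rewrite enum_rankK eqxx.
  by rewrite nth_codom enum_rankK.
by move=> i _; rewrite enum_valK.
Qed.

Section Orthonormal.
Variables (R : realType) (V : vectType R[i]) (dotV : {dot V for Num.conj}).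
Variables (I : finType) (Z : I -> V).
Hypothesis hZ : orthonormal_basis dotV Z.

Lemma orthonormal_basis_inj : injective Z.
Proof. by case: hZ => /orthonormalP[/injectiveP]. Qed.

Lemma orthonormal_basis_dot i j : dotV (Z i) (Z j) = (i == j)%:R.
Proof.
case: hZ => /orthonormalP[_ dZ] _.
by rewrite dZ ?codom_f // (inj_eq orthonormal_basis_inj).
Qed.

(** Expand [u] and [v] in the basis: by sesquilinearity both sides become the same double sum over
    pairs of basis vectors. *)
Lemma adjoint_pair_basis (f g : 'End(V)) :
  (forall i j, dotV (f (Z i)) (Z j) = dotV (Z i) (g (Z j))) ->
  adjoint_pair dotV f g.
Proof.
have inZ v : v \in <<codom Z>>%VS.
  by case: hZ => _ /span_basis ->; exact: memvf.
move=> fg u v; have [a ->] := span_codom (inZ u).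
have [b ->] := span_codom (inZ v).
rewrite [f _]linear_sum [g _]linear_sum !linear_sumlz; apply: eq_bigr => i _.
rewrite !linear_sumr; apply: eq_bigr => j _.
by rewrite /= [f _]linearZ [g _]linearZ !linearZl_LR !linearZr_LR /= fg.
Qed.

Lemma eq_lfun_basis (f g : 'End(V)) : (forall i, f (Z i) = g (Z i)) -> f = g.
Proof.
move=> fg; case: hZ => _ /span_basis spanZ.
by apply/(fullv_lfunP _ _ spanZ) => _ /codomP[i ->].
Qed.

End Orthonormal.

Section XiOnBasis.
Variables (R : realType) (n : nat) (V : vectType R[i]).
Variables (Z : {set 'I_n.+1} -> V) (d ds : 'I_n.+1 -> 'End(V)).
Variables (nu : {set 'I_n.+1} -> {set 'I_n.+1} -> R).
Hypotheses (hd : annihilators Z d) (hds : creators Z ds).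
Implicit Types (j : 'I_n.+1) (s t : {set 'I_n.+1}).

(** Written exactly as the bracket in the theorem, so that the two agree by conversion. *)
Definition phase j s : R[i] :=
  (1 - indic R s j) * expi (- nu_at nu j) + indic R s j * expi (nu_at nu j).

Lemma phaseE j s :
  phase j s = expi (if j \in s then nu_at nu j else - nu_at nu j).
Proof.
rewrite /phase /indic; case: ifP => _; rewrite ?subrr ?subr0;
by rewrite !(mul0r, mul1r, add0r, addr0).
Qed.

(** Toggling flips the membership of [j], hence the sign of the exponent in [phaseE]. *)
Lemma phase_toggle j s :
  phase j (toggle j s) = expi (- if j \in s then nu_at nu j else - nu_at nu j).
Proof.
rewrite phaseE (in_toggle j j s) eqxx addTb if_neg.
by case: ifP; rewrite ?opprK.
Qed.

Lemma Xi_basis j s : Xi nu d ds j (Z s) = phase j s *: Z (toggle j s).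
Proof.
rewrite /Xi lfunE /= !lfunE /= hd hds phaseE /indic /toggle.
case: ifP => _; rewrite ?subrr ?subr0;
by rewrite !(scale0r, scale1r, scaler0, add0r, addr0).
Qed.

(** The phase is nonzero and [Z] is injective, so both can be cancelled. *)
Lemma Xi_eq_toggle j s t :
  injective Z -> (Xi nu d ds j (Z s) = phase j s *: Z t <-> toggle j s = t).
Proof.
move=> Zinj; rewrite Xi_basis; split=> [|-> //].
have phase_neq0 : phase j s != 0 by rewrite phaseE expi_neq0.
by move/(scalerI phase_neq0)/Zinj.
Qed.

Variable dotV : {dot V for Num.conj}.
Hypothesis hZ : orthonormal_basis dotV Z.

Lemma Xi_involutive j : (Xi nu d ds j \o Xi nu d ds j = \1)%VF.
Proof.
apply: (eq_lfun_basis hZ) => s; rewrite lfunE /= id_lfunE Xi_basis linearZ /=.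
by rewrite Xi_basis toggleK scalerA phase_toggle phaseE mulrC expiNl scale1r.
Qed.

Lemma Xi_self_adjoint j : self_adjoint dotV (Xi nu d ds j).
Proof.
apply: (adjoint_pair_basis hZ) => s t.
rewrite !Xi_basis linearZl_LR linearZr_LR /= !(orthonormal_basis_dot hZ).
have [<-|st] := eqVneq (toggle j s) t.
  (* The only nonzero matrix entries: conjugating the phase at the toggle restores the phase at
     [s]. *)
  by rewrite toggleK eqxx phase_toggle conj_expi opprK phaseE.
(* Since toggling is an involution, [s == toggle j t] is equivalent to [toggle j s == t], so the
   right side vanishes too. *)
by rewrite -{2}(toggleK j s) (inj_eq (inv_inj (toggleK j))) (negbTE st) !mulr0.
Qed.

End XiOnBasis.

Theorem theorem3p1 (R : realType) (n : nat)
    (V : vectType R[i]) (dotV : {dot V for Num.conj})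
    (Z : {set 'I_n.+1} -> V) (d ds : 'I_n.+1 -> 'End(V))
    (nu : {set 'I_n.+1} -> {set 'I_n.+1} -> R)
    (hdim : \dim {:V} = (2 ^ n.+1)%N)
    (hZ : orthonormal_basis dotV Z)
    (hd : annihilators Z d) (hds : creators Z ds)
    (hnu : magnetic_potential nu) :
  (forall j : 'I_n.+1, unitary_involution dotV (Xi nu d ds j)) /\
  (forall s t : {set 'I_n.+1},
     adjacent s t <->
     exists! j : 'I_n.+1,
       Xi nu d ds j (Z s) =
         ((1 - indic R s j) * expi (- nu_at nu j)
            + indic R s j * expi (nu_at nu j)) *: Z t).
Proof.
have Zinj := orthonormal_basis_inj hZ.
split=> [j | s t].
- have sa := Xi_self_adjoint nu hd hds hZ j.
  have XX := Xi_involutive nu hd hds hZ j.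
  (* The operator is its own adjoint and its own inverse, so it serves as the witness for
     unitarity. *)
  by split=> //; exists (Xi nu d ds j).
- have E j := Xi_eq_toggle nu hd hds j s t Zinj.
  (* The equivalence [E] holds for every index, so it carries over uniqueness as well as
     existence. *)
  rewrite adjacent_toggle; split=> -[j [js uj]]; exists j; split=> [|k ks].
  + exact/E.
  + exact/uj/E.
  + exact/E.
  + exact/uj/E.
Qed.
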